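(* Let $R$ be an integral domain. Then the following are equivalent: (1) $R$ is a Dedekind domain, i.e. $R$ is an integrally closed Noetherian domain whose nonzero prime ideals are maximal. (2) Every nonzero ideal of $R$ is invertible. (3) The fractional ideals of $R$ form a group under multiplication. (4) Every nonzero proper ideal of $R$ is the product of maximal ideals. (5) $R$ is Noetherian and $R_{\mathfrak{m}}$ is a DVR for each nonzero maximal ideal $\mathfrak{m}$ of $R$. (6) $R$ is Noetherian and $R_{\mathfrak{p}}$ is a DVR for each nonzero prime ideal $\mathfrak{p}$ of $R$. (7) $R$ is a divisibility domain, i.e. $R$ has the property that if $J \subseteq I$, where $I$ and $J$ are nonzero ideals, then $I \mid J$. (8) $R$ is a Noetherian cancellation domain, i.e. $R$ is a Noetherian domain such that if $I_1 J = I_2 J$ then $I_1 = I_2$, for all nonzero ideals $I_1, I_2, J$. (9) For every nonzero ideal $I$ of $R$ there is a nonzero ideal $J$ of $R$ such that $IJ$ is principal.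
   Context: All rings are commutative with unity. Let $K$ be the fraction field of $R$; integrally closed means integrally closed in $K$. Fields are regarded as Dedekind domains. The product of $R$-submodules $I_1,I_2$ of $K$ is the $R$-submodule of all finite sums $\sum_i x_i y_i$ with $x_i\in I_1$, $y_i\in I_2$. An $R$-submodule $I$ of $K$ is invertible if there is an $R$-submodule $J$ of $K$ with $IJ=R$. A fractional ideal of $R$ is a nonzero $R$-submodule $I$ of $K$ such that $xI\subseteq R$ for some $x\in K^\times$; fractional ideals form a commutative monoid under the product with identity $R$. For ideals $I,J$ of $R$, $I\mid J$ means there is an ideal $I'$ of $R$ with $II'=J$. $R_{\mathfrak{p}}$ denotes the localization of $R$ at the prime ideal $\mathfrak{p}$. A discrete valuation of a field $K$ is a surjective group homomorphism $v\colon K^\times \to \mathbb{Z}$ such that $v(x+y)\ge \min\{v(x),v(y)\}$ for all $x,y\in K^\times$ with $x+y\neq 0$; by convention $v(0)=\infty$. A DVR (discrete valuation ring) is any ring of the form $\mathcal{O}_v=\{x\in K \mid v(x)\ge 0\}$, where $K$ is a field and $v$ is a discrete valuation of $K$. *)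

(* Defs.v *)
From mathcomp Require Import all_boot all_order all_algebra.
From mathcomp Require Import boolp classical_sets functions.

Set Implicit Arguments.
Unset Strict Implicit.
Unset Printing Implicit Defensive.

Import GRing.Theory.
Local Open Scope classical_set_scope.
Local Open Scope ring_scope.

(* Used both for ideals of R and for R-submodules of its fraction field. *)
Definition set_prod (A : comNzRingType) (I J : set A) : set A :=
  [set z | exists (n : nat) (x y : 'I_n -> A),
     [/\ forall i, I (x i), forall i, J (y i) & z = \sum_(i < n) x i * y i]].

Definition forms_group (T : Type) (S : set T) (op : T -> T -> T) : Prop :=
  [/\ forall x y, S x -> S y -> S (op x y),
      forall x y z, S x -> S y -> S z -> op x (op y z) = op (op x y) z &
      exists e, [/\ S e,
        forall x, S x -> op e x = x /\ op x e = x &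
        forall x, S x -> exists y, [/\ S y, op x y = e & op y x = e]]].

Section Ideals.
Variable R : comNzRingType.
Implicit Types (I J M P : set R).

(* The unit ideal is allowed, unlike in MathComp's idealr_closed. *)
Definition is_ideal I : Prop :=
  [/\ I 0, forall x y, I x -> I y -> I (x + y) & forall a x, I x -> I (a * x)].

Definition nonzero_ideal I : Prop := is_ideal I /\ I <> [set 0].

Definition prime_ideal P : Prop :=
  [/\ is_ideal P, P <> setT & forall x y, P (x * y) -> P x \/ P y].

Definition maximal_ideal M : Prop :=
  [/\ is_ideal M, M <> setT &
      forall J, is_ideal J -> M `<=` J -> J = M \/ J = setT].

Definition is_principal I : Prop := exists a, I = [set a * x | x in setT].

Definition finitely_generated I : Prop :=
  exists (n : nat) (g : 'I_n -> R),
    I = [set x | exists c : 'I_n -> R, x = \sum_(i < n) c i * g i].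

Definition noetherian : Prop := forall I, is_ideal I -> finitely_generated I.

Definition ideal_dvd I J : Prop :=
  exists I', is_ideal I' /\ set_prod I I' = J.

(* Repetitions are allowed, and the empty product is the unit ideal. *)
Definition product_of_maximal_ideals I : Prop :=
  exists (n : nat) (M : 'I_n -> set R),
    (forall i, maximal_ideal (M i)) /\ I = \big[@set_prod R/setT]_(i < n) M i.

End Ideals.

(* v is a total function on K; its value at 0 is irrelevant, the convention
   v 0 = oo being built into valuation_ring. *)
Definition discrete_valuation (K : fieldType) (v : K -> int) : Prop :=
  [/\ forall x y, x != 0 -> y != 0 -> v (x * y) = v x + v y,
      forall n, exists x, x != 0 /\ v x = n &
      forall x y, x != 0 -> y != 0 -> x + y != 0 ->
        Num.min (v x) (v y) <= v (x + y)].

Definition valuation_ring (K : fieldType) (v : K -> int) : set K :=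
  [set x | x = 0 \/ 0 <= v x].

(* A and B are meant to be subrings; f only matters on A. *)
Definition subring_isom (E F : comNzRingType) (A : set E) (B : set F) : Prop :=
  exists f : E -> F,
    [/\ set_bij A B f, f 1 = 1,
        forall x y, A x -> A y -> f (x + y) = f x + f y &
        forall x y, A x -> A y -> f (x * y) = f x * f y].

(* The field carrying the valuation is arbitrary: being a DVR is a property of
   the ring A, up to isomorphism, not of its embedding into E. *)
Definition is_DVR (E : comNzRingType) (A : set E) : Prop :=
  exists (K : fieldType) (v : K -> int),
    discrete_valuation v /\ subring_isom A (valuation_ring v).

Section Domains.
Variable R : idomainType.
Local Notation K := {fraction R}.
Local Notation toK := (@FracField.tofrac R).
Implicit Types (I J : set K).

Definition is_submodule I : Prop :=
  [/\ I 0, forall x y, I x -> I y -> I (x + y) &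
      forall (a : R) x, I x -> I (toK a * x)].

Definition invertible_submodule I : Prop :=
  is_submodule I /\ exists J, is_submodule J /\ set_prod I J = range toK.

Definition fractional_ideal I : Prop :=
  [/\ is_submodule I, I <> [set 0] &
      exists x : K, x != 0 /\ [set x * y | y in I] `<=` range toK].

(* R_P, realized inside the fraction field of the domain R. *)
Definition localization_at (P : set R) : set K :=
  [set x | exists a s : R, ~ P s /\ x = toK a / toK s].

Definition integrally_closed : Prop :=
  forall x : K, integralOver toK x -> range toK x.

Definition dedekind_domain : Prop :=
  [/\ integrally_closed, noetherian R &
      forall P : set R, prime_ideal P -> P <> [set 0] -> maximal_ideal P].

End Domains.

(* Main.v *)
Require Import Defs.
From mathcomp Require Import all_boot all_order all_algebra.
From mathcomp Require Import boolp classical_sets functions.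
From mathcomp Require Import generic_quotient ring.

(** Every condition is compared with the invertibility of the nonzero ideals.
    For a submodule [X] of the fraction field, invertibility amounts to
    [1 \in X X^-1], where [X^-1] consists of all [y] with [y X <= R].

    Invertibility implies the rest almost formally. A relation
    [1 = \sum x_i y_i] in [I I^-1] shows that [I] is generated by the [x_i], so [R] is Noetherian; invertible
    ideals can be cancelled; if [J <= I] then [J = I (I^-1 J)]; fractional
    ideals are multiples of ideals, hence invertible too; and dividing an ideal
    by a maximal ideal containing it makes it strictly larger, so by Noetherian
    induction the process ends in a product of maximal ideals. At a nonzero
    prime [P], an element [p] of [P] outside [P^2] generates [P] locally, and
    each nonzero fraction is a power of [p] times a unit of [R_P]; the exponent
    is the valuation ([localization_is_DVR]).

    Invertibility is recovered as follows.
    - A factor of a nonzero principal ideal is invertible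
      ([principal_prod_invertible]). This settles the existence of principal
      multiples, thereby divisibility, and also factorization into maximal
      ideals, by which each nonzero maximal ideal divides a nonzero principal
      ideal.
    - The neutral element of the group of fractional ideals is [R].
    - When the localizations are DVRs, an ideal is generated at each
      maximal ideal [M] by one of its elements [a]. Clearing denominators gives [s] outside [M] with [s / a]
      in [I^-1], so [I I^-1] lies in no maximal ideal
      ([locally_DVR_invertible]).
    - In a Dedekind domain, a nonzero prime [P] has an [x] in [P^-1] outside [R]
      ([inverse_of_prime_gt]). As [x] is not integral, it cannot stabilize a
      nonzero ideal, so [I P^-1] is strictly larger than [I] whenever
      [I <= P], and Noetherian induction applies ([dedekind_invertible]).
    - A Noetherian cancellation domain is Dedekind. If [x] is integral, [R[x]]
      is idempotent and has a multiple that is an ideal, so [R[x] = R]. Next,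
      cancelling in [(a, b)^3 = (a^2, b^2) (a, b)] gives
      [a b \in (a^2, b^2)], a quadratic equation for [a / b]; with integral
      closure it yields [P = P (P + (x))] for each nonzero prime [P] and [x]
      outside it, and hence [P + (x) = R]. *)

Set Implicit Arguments.
Unset Strict Implicit.
Unset Printing Implicit Defensive.

Import Order.TTheory GRing.Theory Num.Theory.

Local Open Scope classical_set_scope.
Local Open Scope ring_scope.

(** * Products of subsets of a ring *)

Section Products.
Variable A : comNzRingType.
Implicit Types (I J L T : set A).

Lemma set_prod_mul I J x y : I x -> J y -> set_prod I J (x * y).
Proof.
move=> Ix Jy; exists 1%N, (fun=> x), (fun=> y).
by split=> //; rewrite big_ord1.
Qed.

(** The induction principle by which all inclusions between products are
    proved: [set_prod I J] is the least additive submonoid containing the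
    elementary products, whatever the sets [I] and [J] are. *)
Lemma set_prod_sub I J T : T 0 -> (forall x y, T x -> T y -> T (x + y)) ->
  (forall x y, I x -> J y -> T (x * y)) -> set_prod I J `<=` T.
Proof.
move=> T0 TD TM _ [n [x [y [Ix Jy ->]]]].
by apply: big_ind => // i _; apply: TM.
Qed.

Lemma set_prod0 I J : set_prod I J 0.
Proof.
by exists 0%N, (fun=> 0), (fun=> 0); split=> [[]|[]|] //; rewrite big_ord0.
Qed.

Lemma set_prodD I J z w :
  set_prod I J z -> set_prod I J w -> set_prod I J (z + w).
Proof.
move=> [m [x [y [Ix Jy ->]]]] [n [x' [y' [Ix' Jy' ->]]]].
pose glue (f : 'I_m -> A) (g : 'I_n -> A) (i : 'I_(m + n)) :=
  match fintype.split i with inl j => f j | inr k => g k end.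
exists (m + n)%N, (glue x x'), (glue y y'); split.
- by move=> i; rewrite /glue; case: (fintype.split i).
- by move=> i; rewrite /glue; case: (fintype.split i).
rewrite big_split_ord /=; congr (_ + _); apply: eq_bigr => i _; rewrite /glue.
  by rewrite (unsplitK (inl i) : fintype.split (lshift n i) = _).
by rewrite (unsplitK (inr i) : fintype.split (rshift m i) = _).
Qed.

Lemma set_prodS I J I' J' : I `<=` I' -> J `<=` J' ->
  set_prod I J `<=` set_prod I' J'.
Proof.
move=> sI sJ; apply: set_prod_sub; first exact: set_prod0.
  exact: set_prodD.
by move=> x y /sI Ix /sJ Jy; apply: set_prod_mul.
Qed.

Lemma set_prodC I J : set_prod I J = set_prod J I.
Proof.
have sub L T : set_prod L T `<=` set_prod T L.
  apply: set_prod_sub; [exact: set_prod0|exact: set_prodD|].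
  by move=> x y Lx Ty; rewrite mulrC; apply: set_prod_mul.
by apply/seteqP; split; apply: sub.
Qed.

Lemma set_prodA I J L : set_prod I (set_prod J L) = set_prod (set_prod I J) L.
Proof.
have sub I' J' L' :
    set_prod I' (set_prod J' L') `<=` set_prod (set_prod I' J') L'.
  apply: set_prod_sub; [exact: set_prod0|exact: set_prodD|move=> x w I'x].
  apply: (@set_prod_sub _ _ (fun w => set_prod (set_prod I' J') L' (x * w))).
  - by rewrite mulr0; apply: set_prod0.
  - by move=> u v xu xv; rewrite mulrDr; apply: set_prodD.
  - move=> y z J'y L'z; rewrite mulrA; apply: set_prod_mul => //.
    exact: set_prod_mul.
apply/seteqP; split; first exact: sub.
rewrite set_prodC [set_prod I J]set_prodC [set_prod I _]set_prodC.
by rewrite [set_prod J L]set_prodC; apply: sub.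
Qed.

Lemma set_prodMl I J a : (forall x, I x -> I (a * x)) ->
  forall z, set_prod I J z -> set_prod I J (a * z).
Proof.
move=> Ia; apply: (@set_prod_sub _ _ (fun z => set_prod I J (a * z))).
- by rewrite mulr0; apply: set_prod0.
- by move=> u v xu xv; rewrite mulrDr; apply: set_prodD.
- by move=> x y Ix Jy; rewrite mulrA; apply: set_prod_mul => //; apply: Ia.
Qed.

End Products.

(** * Ideals *)

Section IdealTheory.
Variable R : comNzRingType.
Implicit Types (I J P M : set R).

Definition principal_ideal (a : R) : set R := [set a * x | x in setT].

Lemma principal_idealP a z : principal_ideal a z <-> exists c, z = c * a.
Proof.
by split=> [[x _ <-]|[c ->]]; [exists x|exists c => //]; rewrite mulrC.
Qed.

Lemma principal_is_ideal a : is_ideal (principal_ideal a).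
Proof.
split; first by exists 0 => //; rewrite mulr0.
  by move=> _ _ [x _ <-] [y _ <-]; exists (x + y) => //; rewrite mulrDr.
by move=> c _ [x _ <-]; exists (c * x) => //; rewrite mulrCA.
Qed.

Lemma principal_id a : principal_ideal a a.
Proof. by exists 1 => //; rewrite mulr1. Qed.

Lemma principal_sub a I : is_ideal I -> I a -> principal_ideal a `<=` I.
Proof. by move=> [_ _ IM] Ia z /principal_idealP [c ->]; apply: IM. Qed.

Lemma setT_ideal : is_ideal [set: R].
Proof. by []. Qed.

Lemma ideal_setT I : is_ideal I -> I 1 -> I = setT.
Proof.
move=> [_ _ IM] I1; apply/seteqP; split=> // x _.
by rewrite -[x]mulr1; apply: IM.
Qed.

Lemma ideal_prod I J : is_ideal I -> is_ideal J -> is_ideal (set_prod I J).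
Proof.
move=> [_ _ IM] _; split; [exact: set_prod0|exact: set_prodD|].
by move=> a; apply: set_prodMl; apply: IM.
Qed.

Lemma ideal_prodT I : is_ideal I -> set_prod I setT = I.
Proof.
move=> [I0 ID IM]; apply/seteqP; split.
  by apply: set_prod_sub => // x y Ix _; rewrite mulrC; apply: IM.
by move=> x Ix; rewrite -[x]mulr1; apply: set_prod_mul.
Qed.

Lemma ideal_prod_subl I J : is_ideal I -> set_prod I J `<=` I.
Proof. by move=> II; rewrite -{2}(ideal_prodT II); apply: set_prodS. Qed.

Lemma nonzero_idealP I :
  nonzero_ideal I <-> is_ideal I /\ exists2 a, I a & a != 0.
Proof.
split=> [[II In0]|[II [a Ia an0]]]; split=> //.
  apply: contrapT => noa; apply: In0; case: (II) => I0 _ _.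
  apply/seteqP; split=> [x Ix|x ->//]; apply: contrapT => /eqP xn0.
  by apply: noa; exists x.
by move=> I0; move: Ia an0; rewrite I0 => ->; rewrite eqxx.
Qed.

Lemma maximal_prime M : maximal_ideal M -> prime_ideal M.
Proof.
move=> [MI MT Mmax]; split=> // x y Mxy.
case: (MI) => M0 MD MM; apply: contrapT => /not_orP [nMx nMy].
pose N := [set z | exists m c, M m /\ z = m + c * x].
have NI : is_ideal N.
  split; first by exists 0, 0; split=> //; rewrite mul0r addr0.
    move=> _ _ [m [c [Mm ->]]] [m' [c' [Mm' ->]]].
    by exists (m + m'), (c + c'); split; [apply: MD|ring].
  move=> a _ [m [c [Mm ->]]]; exists (a * m), (a * c).
  by split; [apply: MM|ring].
case: (Mmax N NI) => [z Mz|NM|NT].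
- by exists z, 0; split=> //; rewrite mul0r addr0.
- by apply: nMx; rewrite -NM; exists 0, 1; split=> //; ring.
have [m [c [Mm e]]] : N 1 by rewrite NT.
apply: nMy; rewrite -[y]mul1r e mulrDl; apply: MD.
  by rewrite mulrC; apply: MM.
by rewrite -mulrA; apply: MM.
Qed.

Lemma prime_ideal1 P : prime_ideal P -> ~ P 1.
Proof. by move=> [PI PT _] P1; apply: PT; apply: ideal_setT. Qed.

Lemma prime_idealM P : prime_ideal P -> forall x y, ~ P x -> ~ P y -> ~ P (x * y).
Proof. by move=> [_ _ PP] x y nx ny /PP []. Qed.

Lemma prime_prod_sub P I J : prime_ideal P -> is_ideal J ->
  set_prod I J `<=` P -> I `<=` P \/ J `<=` P.
Proof.
move=> [_ _ PP] JI sP; have [sI|/existsNP [x /not_implyP [Ix nPx]]] :=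
  pselect (I `<=` P); [by left|right => y Jy].
by have [|//] := PP x y (sP _ (set_prod_mul Ix Jy)).
Qed.

End IdealTheory.

(** * Noetherian rings *)

Section Noetherian.
Variable R : comNzRingType.
Implicit Types (I J : set R).

Lemma span_gen n (g : 'I_n -> R) i :
  [set x | exists c : 'I_n -> R, x = \sum_(i < n) c i * g i] (g i).
Proof.
exists (fun j => (j == i)%:R); rewrite (bigD1 i) //= eqxx mul1r big1 ?addr0 //.
by move=> j /negPf ->; rewrite mul0r.
Qed.

(** An infinite strictly ascending chain would have a finitely generated
    union; all the generators lie in one member of the chain, which is then the
    whole union. *)
Lemma noetherian_maximal (F : set (set R)) : noetherian R ->
  (forall I, F I -> is_ideal I) -> F !=set0 ->
  exists2 I, F I & forall J, F J -> I `<=` J -> J = I.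
Proof.
move=> noeth FI [I0 FI0]; apply: contrapT => nomax.
have step (I : {I : set R | F I}) :
    {J : {J : set R | F J} | sval I `<` sval J}.
  apply: cid; apply: contrapT => noJ; apply: nomax.
  exists (sval I) => [|J FJ IJ]; first exact: (svalP I).
  apply: contrapT => JI; apply: noJ; exists (exist _ J FJ); split=> // JI'.
  by apply: JI; apply/seteqP.
have [f [_ fS]] := dependent_choice step (exist _ I0 FI0).
pose C n := sval (f n).
have CI n : is_ideal (C n) by apply: FI; apply: (svalP (f n)).
have Cmono m n : (m <= n)%N -> C m `<=` C n.
  move=> /subnK <-; elim: (n - m)%N => [//|k IHk]; rewrite addSn.
  by apply: subset_trans IHk _; apply: properW; apply: fS.
pose U := \bigcup_n C n.
have UI : is_ideal U.
  split; first by exists 0%N => //; case: (CI 0%N).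
    move=> x y [m _ Cx] [n _ Cy]; exists (maxn m n) => //.
    case: (CI (maxn m n)) => _ CD _; apply: CD.
      by apply: Cmono Cx; apply: leq_maxl.
    by apply: Cmono Cy; apply: leq_maxr.
  by move=> a x [m _ Cx]; exists m => //; case: (CI m) => _ _; apply.
have [n [g Ug]] := noeth U UI.
have gU i : exists k, C k (g i).
  by have : U (g i); [rewrite Ug; apply: span_gen|case=> k _; exists k].
have [k Ck] := choice gU.
pose N := \max_(i < n) k i.
have [_] := fS N; apply=> x Cx.
have : U x by exists N.+1.
rewrite Ug => -[c ->]; case: (CI N) => CN0 CND CNM.
apply: big_ind => // i _; apply: CNM; apply: Cmono (Ck i).
exact: (leq_bigmax i).
Qed.

Lemma noetherian_ind (Q : set R -> Prop) : noetherian R ->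
  (forall I, is_ideal I -> (forall J, is_ideal J -> I `<` J -> Q J) -> Q I) ->
  forall I, is_ideal I -> Q I.
Proof.
move=> noeth IH I II; apply: contrapT => nQI.
have [|||J [JI nQJ] Jmax] := @noetherian_maximal [set J | is_ideal J /\ ~ Q J].
- by [].
- by move=> J [].
- by exists I.
apply: nQJ; apply: IH => // L LI JL; apply: contrapT => nQL.
by have := JL; rewrite (Jmax L (conj LI nQL) (properW JL)) => -[_]; apply.
Qed.

Lemma ex_maximal_ideal I : noetherian R -> is_ideal I -> I <> setT ->
  exists2 M, maximal_ideal M & I `<=` M.
Proof.
move=> noeth II IT.
pose F := [set J : set R | [/\ is_ideal J, I `<=` J & J <> setT]].
have [|||M [MI IM MT] Mmax] := @noetherian_maximal F.
- by [].
- by move=> J [].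
- by exists I; split.
exists M => //; split=> // J JI MJ.
have [->|JT] := pselect (J = setT); [by right|left; apply: Mmax => //].
by split=> //; apply: subset_trans MJ.
Qed.

End Noetherian.

(** * Submodules of the fraction field *)

Section Submodules.
Variable R : idomainType.
Local Notation K := {fraction R}.
Local Notation toK := (@FracField.tofrac R).
Implicit Types (I J P M : set R) (X Y : set K).

Lemma toK_inj : injective toK.
Proof. by move=> a b /eqP; rewrite tofrac_eq => /eqP. Qed.

Lemma toK_neq0 a : a != 0 -> toK a != 0.
Proof. by rewrite tofrac_eq0. Qed.

Lemma fractionP (x : K) : exists a b : R, b != 0 /\ x = toK a / toK b.
Proof.
rewrite -[x]reprK; move: (repr x) => r {x}; exists (frac r).1, (frac r).2.
have d0 := denom_ratioP r; split=> //.
apply/esym/(canLR (mulfK (toK_neq0 d0))); unlock FracField.tofrac.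
rewrite -[RHS]FracField.pi_mul; apply/eqmodP.
rewrite /= FracField.equivfE /FracField.mulf /=.
by rewrite !numden_Ratio ?mulr1 ?oner_neq0 // mul1r.
Qed.

Lemma toK_image I a : (toK @` I) (toK a) <-> I a.
Proof. by split=> [[b Ib /toK_inj <-]|Ia] //; exists a. Qed.

Lemma toK_image_inj I J : toK @` I = toK @` J -> I = J.
Proof.
by move=> e; apply/seteqP; split=> a /toK_image; [rewrite e|rewrite -e];
   move/toK_image.
Qed.

Lemma toK_image_prod I J :
  toK @` set_prod I J = set_prod (toK @` I) (toK @` J).
Proof.
apply/seteqP; split.
  move=> _ [z + <-]; move: z.
  apply: (@set_prod_sub _ _ _ (fun z => set_prod (toK @` I) (toK @` J) (toK z))).
  - by rewrite rmorph0; apply: set_prod0.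
  - by move=> u v xu xv; rewrite rmorphD; apply: set_prodD.
  - by move=> x y Ix Jy; rewrite rmorphM; apply: set_prod_mul; apply/toK_image.
apply: set_prod_sub.
- by exists 0; [exact: set_prod0|rewrite rmorph0].
- move=> _ _ [u Iu <-] [v Iv <-]; exists (u + v); last by rewrite rmorphD.
  exact: set_prodD.
- move=> _ _ [u Iu <-] [v Iv <-]; exists (u * v); last by rewrite rmorphM.
  exact: set_prod_mul.
Qed.

Lemma ideal_submodule I : is_ideal I -> is_submodule (toK @` I).
Proof.
move=> [I0 ID IM]; split; first by exists 0; rewrite ?rmorph0.
  move=> _ _ [x Ix <-] [y Iy <-]; exists (x + y); last by rewrite rmorphD.
  exact: ID.
move=> a _ [x Ix <-]; exists (a * x); last by rewrite rmorphM.
exact: IM.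
Qed.

Lemma submodule_preimage X : is_submodule X -> is_ideal (toK @^-1` X).
Proof.
move=> [X0 XD XM]; split; rewrite /preimage /=; first by rewrite rmorph0.
  by move=> x y Xx Xy; rewrite rmorphD; apply: XD.
by move=> a x Xx; rewrite rmorphM; apply: XM.
Qed.

Lemma image_preimage_toK X : X `<=` range toK -> toK @` (toK @^-1` X) = X.
Proof.
move=> sX; apply/seteqP; split=> [_ [a Xa <-]//|x Xx].
by have [a _ ax] := sX x Xx; exists a; rewrite // /preimage /= ax.
Qed.

Lemma range_submodule : is_submodule (range toK).
Proof. exact/ideal_submodule/setT_ideal. Qed.

Lemma range1 : range toK 1.
Proof. by exists 1; rewrite ?rmorph1. Qed.

Lemma submodule_prod X Y : is_submodule X -> is_submodule (set_prod X Y).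
Proof.
move=> [_ _ XM]; split; [exact: set_prod0|exact: set_prodD|].
by move=> a; apply: set_prodMl; apply: XM.
Qed.

Lemma submodule_prod1 X : is_submodule X -> set_prod X (range toK) = X.
Proof.
move=> [X0 XD XM]; apply/seteqP; split.
  by apply: set_prod_sub => // x _ Xx [a _ <-]; rewrite mulrC; apply: XM.
by move=> x Xx; rewrite -[x]mulr1; apply: set_prod_mul => //; apply: range1.
Qed.

(** * Invertibility *)

(** The colon module [(R : X)]. *)
Definition inv_submodule X : set K :=
  [set y | forall x, X x -> range toK (x * y)].

Lemma inv_submodule_submodule X : is_submodule (inv_submodule X).
Proof.
case: range_submodule => R0 RD RM; split.
- by move=> x _; rewrite mulr0.
- by move=> y z Xy Xz x Xx; rewrite mulrDr; apply: RD; [apply: Xy|apply: Xz].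
- by move=> a y Xy x Xx; rewrite mulrCA; apply: RM; apply: Xy.
Qed.

Lemma prod_inv_sub X : set_prod X (inv_submodule X) `<=` range toK.
Proof.
case: range_submodule => R0 RD _.
by apply: set_prod_sub => // x y Xx; apply.
Qed.

Lemma prod_inv X : is_submodule X -> set_prod X (inv_submodule X) 1 ->
  set_prod X (inv_submodule X) = range toK.
Proof.
move=> XS X1; apply/seteqP; split; first exact: prod_inv_sub.
move=> _ [a _ <-]; rewrite -[toK a]mulr1.
by have [_ _] := submodule_prod (inv_submodule X) XS; apply.
Qed.

(** An inverse of [X], if there is one, lies in [inv_submodule X]; so
    invertibility is the single membership [1 \in X X^-1]. *)
Lemma invertibleP X : invertible_submodule X <->
  is_submodule X /\ set_prod X (inv_submodule X) 1.
Proof.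
split=> [[XS [Y [YS XY]]]|[XS X1]]; split=> //.
  have: set_prod X Y 1 by rewrite XY; apply: range1.
  apply: set_prodS => // y Yy x Xx; rewrite -XY; exact: set_prod_mul.
exists (inv_submodule X); split; last exact: prod_inv.
exact: inv_submodule_submodule.
Qed.

Lemma invertible_mul X Y : invertible_submodule X -> invertible_submodule Y ->
  invertible_submodule (set_prod X Y).
Proof.
move=> [XS [X' [X'S XX']]] [YS [Y' [Y'S YY']]].
split; first exact: submodule_prod.
exists (set_prod Y' X'); split; first exact: submodule_prod.
by rewrite -set_prodA [set_prod Y _]set_prodA YY' [set_prod (range _) _]set_prodC
  submodule_prod1.
Qed.

Lemma invertible_range : invertible_submodule (range toK).
Proof.
split; first exact: range_submodule.
exists (range toK); split; first exact: range_submodule.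
exact/submodule_prod1/range_submodule.
Qed.

Lemma invertible_cancel I I1 I2 : invertible_submodule (toK @` I) ->
  is_ideal I1 -> is_ideal I2 -> set_prod I1 I = set_prod I2 I -> I1 = I2.
Proof.
move=> [IS [Y [YS IY]]] II1 II2 /(congr1 (fun J => set_prod (toK @` J) Y)).
rewrite !toK_image_prod -!set_prodA IY !submodule_prod1; try exact: ideal_submodule.
exact: toK_image_inj.
Qed.

Lemma invertible_dvd I J : invertible_submodule (toK @` I) -> is_ideal J ->
  J `<=` I -> ideal_dvd I J.
Proof.
move=> [IS [Y [YS IY]]] JI sJI; have YJ := submodule_prod (toK @` J) YS.
exists (toK @^-1` set_prod Y (toK @` J)); split.
  exact: submodule_preimage.
apply: toK_image_inj; rewrite toK_image_prod image_preimage_toK; last first.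
  rewrite -IY set_prodC; apply: set_prodS => // _ [a Ja <-].
  by exists a => //; apply: sJI.
rewrite set_prodA IY set_prodC submodule_prod1 //; exact: ideal_submodule.
Qed.

(** If [I J = (a)] then [a^-1 J] is inverse to [I]. *)
Lemma principal_prod_invertible I J a : is_ideal I -> a != 0 ->
  set_prod I J = principal_ideal a -> invertible_submodule (toK @` I).
Proof.
move=> II a0 IJ; have a0' := toK_neq0 a0.
apply/invertibleP; split; first exact: ideal_submodule.
rewrite -(divff a0').
suff sub : set_prod I J `<=` [set z |
    set_prod (toK @` I) (inv_submodule (toK @` I)) (toK z / toK a)].
  by apply: sub; rewrite IJ; apply: principal_id.
apply: set_prod_sub => /=.
- by rewrite rmorph0 mul0r; apply: set_prod0.
- by move=> u v xu xv; rewrite rmorphD mulrDl; apply: set_prodD.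
move=> x y Ix Jy; rewrite rmorphM -mulrA; apply: set_prod_mul.
  exact/toK_image.
move=> _ [i Ii <-].
have : set_prod I J (i * y) by apply: set_prod_mul.
rewrite IJ => /principal_idealP [c ciy].
by exists c => //; rewrite mulrA -rmorphM ciy rmorphM mulfK.
Qed.

End Submodules.

(** * Consequences of invertibility *)

Section Invertible.
Variable R : idomainType.
Local Notation K := {fraction R}.
Local Notation toK := (@FracField.tofrac R).
Implicit Types (I J P M : set R) (X Y : set K).

Definition ideals_invertible :=
  forall I, nonzero_ideal I -> invertible_submodule (toK @` I).

Lemma nonzero_ideal_prod I J : nonzero_ideal I -> nonzero_ideal J ->
  nonzero_ideal (set_prod I J).
Proof.
move=> /nonzero_idealP [II [a Ia a0]] /nonzero_idealP [JI [b Jb b0]].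
apply/nonzero_idealP; split; first exact: ideal_prod.
by exists (a * b); [apply: set_prod_mul|rewrite mulf_neq0].
Qed.

Lemma nonzero_idealS I J : nonzero_ideal I -> is_ideal J -> I `<=` J ->
  nonzero_ideal J.
Proof.
move=> /nonzero_idealP [II [a Ia a0]] JI IJ; apply/nonzero_idealP.
by split=> //; exists a => //; apply: IJ.
Qed.

Lemma nonzero_principal (a : R) : a != 0 -> nonzero_ideal (principal_ideal a).
Proof.
move=> a0; apply/nonzero_idealP; split; first exact: principal_is_ideal.
by exists a => //; apply: principal_id.
Qed.

(** If [1 = \sum x_i y_i] with [x_i] in [I] and [y_i] in its inverse, then
    every [b] in [I] is [\sum (b y_i) x_i]. *)
Lemma invertible_finitely_generated I : invertible_submodule (toK @` I) ->
  finitely_generated I.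
Proof.
move=> [IS [Y [YS IY]]].
have : set_prod (toK @` I) Y 1 by rewrite IY; apply: range1.
move=> [n [x [y [Ix Yy e1]]]].
have [g Ig] : {g : 'I_n -> R & forall i, I (g i) /\ toK (g i) = x i}.
  by apply: (@choice _ _ (fun i a => I a /\ toK a = x i)) => i;
     case: (Ix i) => a Ia <-; exists a.
have [I0 ID IM] : is_ideal I.
  have -> : I = toK @^-1` (toK @` I).
    by apply/seteqP; split=> a Ia; apply/(toK_image I a).
  exact: submodule_preimage.
exists n, g; apply/seteqP; split=> [b Ib|_ [c ->]]; last first.
  by apply: big_ind => // i _; apply: IM; case: (Ig i).
have bY i : exists c, toK c = toK b * y i.
  have : range toK (toK b * y i).
    by rewrite -IY; apply: set_prod_mul => //; apply/toK_image.
  by case=> c _ <-; exists c.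
have [c cE] := choice bY; exists c; apply: toK_inj.
rewrite -[toK b]mulr1 e1 mulr_sumr rmorph_sum; apply: eq_bigr => i _ /=.
by rewrite rmorphM /= cE; case: (Ig i) => _ ->; rewrite mulrA mulrAC.
Qed.

Lemma set0_finitely_generated : finitely_generated [set (0 : R)].
Proof.
exists 0%N, (fun=> 0); apply/seteqP; split=> [x ->|x [c ->]].
  by exists (fun=> 0); rewrite big_ord0.
by rewrite big_ord0.
Qed.

Lemma ideals_invertible_noetherian : ideals_invertible -> noetherian R.
Proof.
move=> inv I II; have [->|In0] := pselect (I = [set 0]).
  exact: set0_finitely_generated.
by apply: invertible_finitely_generated; apply: inv.
Qed.

Lemma ideals_invertible_cancel I1 I2 J : ideals_invertible ->
  nonzero_ideal I1 -> nonzero_ideal I2 -> nonzero_ideal J ->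
  set_prod I1 J = set_prod I2 J -> I1 = I2.
Proof.
by move=> inv [I1I _] [I2I _] /inv Jinv; apply: invertible_cancel.
Qed.

Lemma ideals_invertible_dvd I J : ideals_invertible ->
  nonzero_ideal I -> nonzero_ideal J -> J `<=` I -> ideal_dvd I J.
Proof. by move=> inv /inv II [JI _]; apply: invertible_dvd. Qed.

(** Apply divisibility to a nonzero principal ideal inside [I]. *)
Lemma divisibility_principal_multiple :
  (forall I J, nonzero_ideal I -> nonzero_ideal J -> J `<=` I ->
     ideal_dvd I J) ->
  forall I, nonzero_ideal I ->
    exists J, nonzero_ideal J /\ is_principal (set_prod I J).
Proof.
move=> dvd I In; have /nonzero_idealP [II [a Ia a0]] := In.
have [J [JI IJ]] := dvd I _ In (nonzero_principal a0) (principal_sub II Ia).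
exists J; split; last by exists a; rewrite IJ.
split=> // J0; have := principal_id a; rewrite -IJ J0 => aIJ.
suff : [set 0] a by move=> a0'; rewrite a0' eqxx in a0.
move: aIJ; apply: set_prod_sub => //= x y; first by move=> -> ->; rewrite addr0.
by move=> _ ->; rewrite mulr0.
Qed.

Lemma principal_multiple_invertible :
  (forall I, nonzero_ideal I ->
     exists J, nonzero_ideal J /\ is_principal (set_prod I J)) ->
  ideals_invertible.
Proof.
move=> mult I In; have [J [Jn [a aE]]] := mult I In.
have [II _] := In.
apply: (@principal_prod_invertible R I J a) => //.
apply: contra_not_neq (nonzero_ideal_prod In Jn).2 => a0.
rewrite aE a0; apply/seteqP; split=> [_ [x _ <-]|_ ->]; first by rewrite mul0r.
by exists 0; rewrite ?mul0r.
Qed.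

(** * The group of fractional ideals *)

Lemma submodule_neq0P X : is_submodule X ->
  X <> [set 0] <-> exists2 x, X x & x != 0.
Proof.
move=> [X0 _ _]; split=> [Xn0|[x Xx x0] XE]; last first.
  by move: Xx x0; rewrite XE => ->; rewrite eqxx.
apply: contrapT => nox; apply: Xn0.
apply/seteqP; split=> [x Xx|_ ->//]; apply: contrapT => /eqP xn0.
by apply: nox; exists x.
Qed.

Lemma fractional_ideal_prod X Y : fractional_ideal X -> fractional_ideal Y ->
  fractional_ideal (set_prod X Y).
Proof.
move=> [XS /(submodule_neq0P XS) [x Xx x0] [d [d0 dX]]].
move=> [YS /(submodule_neq0P YS) [y Yy y0] [e [e0 eY]]].
have XYS := submodule_prod Y XS; split=> //.
  by apply/(submodule_neq0P XYS); exists (x * y);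
     [apply: set_prod_mul|rewrite mulf_neq0].
exists (d * e); split; first by rewrite mulf_neq0.
have [R0 RD RM] := range_submodule R.
suff sub : set_prod X Y `<=` [set z | range toK (d * e * z)].
  by move=> _ [z /sub ? <-].
apply: set_prod_sub => /=; first by rewrite mulr0.
  by move=> u v; rewrite mulrDr; apply: RD.
move=> u v Xu Yv; rewrite mulrACA.
have [a _ <-] : range toK (d * u) by apply: dX; exists u.
by apply: RM; apply: eY; exists v.
Qed.

Lemma ideal_fractional I : nonzero_ideal I -> fractional_ideal (toK @` I).
Proof.
move=> /nonzero_idealP [II [a Ia a0]]; have IS := ideal_submodule II.
split=> //.
  by apply/(submodule_neq0P IS); exists (toK a); [apply/toK_image|apply: toK_neq0].
exists 1; split; first exact: oner_neq0.
by move=> _ [_ [b _ <-] <-]; exists b; rewrite ?mul1r.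
Qed.

Lemma range_fractional : fractional_ideal (range toK).
Proof.
apply: ideal_fractional; apply/nonzero_idealP; split; first exact: setT_ideal.
by exists 1 => //; apply: oner_neq0.
Qed.

(** A fractional ideal is [d^-1 I] for an ideal [I], so it is invertible
    along with [I]. *)
Lemma fractional_ideal_invertible X : ideals_invertible ->
  fractional_ideal X -> set_prod X (inv_submodule X) 1.
Proof.
move=> inv [XS /(submodule_neq0P XS) [x Xx x0] [d [d0 dX]]].
pose Z := [set d * y | y in X]; have [X0 XD XM] := XS.
have ZS : is_submodule Z.
  split; first by exists 0; rewrite ?mulr0.
    move=> _ _ [u Xu <-] [v Xv <-]; exists (u + v); last by rewrite mulrDr.
    exact: XD.
  move=> a _ [u Xu <-]; exists (toK a * u); last by rewrite mulrCA.
  exact: XM.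
have ZE : toK @` (toK @^-1` Z) = Z := image_preimage_toK dX.
have In : nonzero_ideal (toK @^-1` Z).
  apply/nonzero_idealP; split; first exact: submodule_preimage.
  have [a _ ax] : range toK (d * x) by apply: dX; exists x.
  exists a; first by rewrite /preimage /= ax; exists x.
  by rewrite -(tofrac_eq0 a) ax mulf_neq0.
have /invertibleP [_] := inv _ In; rewrite ZE.
apply: set_prod_sub; [exact: set_prod0|exact: set_prodD|].
move=> _ y [u Xu <-] Zy; rewrite [d * u]mulrC -mulrA; apply: set_prod_mul => //.
by move=> v Xv; rewrite mulrCA mulrA; apply: Zy; exists v.
Qed.

Lemma inv_submodule_fractional X : fractional_ideal X ->
  set_prod X (inv_submodule X) 1 -> fractional_ideal (inv_submodule X).
Proof.
move=> [XS /(submodule_neq0P XS) [x Xx x0] _] X1.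
have iS := inv_submodule_submodule X; split=> //.
  move=> i0; move: X1; rewrite i0 => X1.
  suff : [set 0] (1 : K) by move/eqP; rewrite oner_eq0.
  move: X1; apply: set_prod_sub => //= u v; first by move=> -> ->; rewrite addr0.
  by move=> _ ->; rewrite mulr0.
by exists x; split=> // _ [y Xy <-]; apply: Xy.
Qed.

Lemma ideals_invertible_group : ideals_invertible ->
  forms_group (@fractional_ideal R) (@set_prod K).
Proof.
move=> inv; split; first exact: fractional_ideal_prod.
  by move=> X Y Z _ _ _; apply: set_prodA.
exists (range toK); split; first exact: range_fractional.
  move=> X [XS _ _]; rewrite [set_prod (range _) _]set_prodC.
  by rewrite submodule_prod1.
move=> X Xf; have X1 := fractional_ideal_invertible inv Xf; have [XS _ _] := Xf.
exists (inv_submodule X); split; first exact: inv_submodule_fractional.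
  exact: prod_inv.
by rewrite set_prodC; apply: prod_inv.
Qed.

(** The neutral element has to be [R], since it fixes the fractional ideal
    [R]. *)
Lemma group_ideals_invertible :
  forms_group (@fractional_ideal R) (@set_prod K) -> ideals_invertible.
Proof.
move=> [_ _ [e [[eS _ _] e1 einv]]] I In.
have eR : e = range toK.
  by rewrite -(submodule_prod1 eS); case: (e1 _ range_fractional).
have [Y [[YS _ _] IY _]] := einv _ (ideal_fractional In).
split; first by case: In => II _; apply: ideal_submodule.
by exists Y; rewrite IY.
Qed.

(** * Products of maximal ideals *)

Lemma product_of_maximal_cons M J : maximal_ideal M ->
  product_of_maximal_ideals J -> product_of_maximal_ideals (set_prod M J).
Proof.
move=> MM [n [N [NM ->]]].
exists n.+1, (fun i => if unlift ord0 i is Some j then N j else M).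
split; first by move=> i; case: (unlift ord0 i).
rewrite big_ord_recl unlift_none; congr (set_prod _ _).
by apply: eq_bigr => i _; rewrite liftK.
Qed.

(** Noetherian induction: if [I] is contained in the maximal ideal [M], then
    [I = M J] with [I <= J], and [J = I] would cancel to [M = R]. *)
Lemma ideals_invertible_product_of_maximal : ideals_invertible ->
  forall I, nonzero_ideal I -> product_of_maximal_ideals I.
Proof.
move=> inv I In; have noeth := ideals_invertible_noetherian inv.
have [II _] := In; move: I II In.
apply: (@noetherian_ind _ (fun I => nonzero_ideal I ->
  product_of_maximal_ideals I)) => // I II IH In.
have [->|IT] := pselect (I = setT).
  by exists 0%N, (fun=> setT); split=> [[]|] //; rewrite big_ord0.
have [M MM IM] := ex_maximal_ideal noeth II IT.
have [MI MT _] := MM; have Mn := nonzero_idealS In MI IM.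
have [J [JI MJ]] := ideals_invertible_dvd inv Mn In IM.
have IJ : I `<=` J by rewrite -MJ set_prodC; apply: ideal_prod_subl.
rewrite -MJ; apply: product_of_maximal_cons => //.
apply: IH => //; last exact: nonzero_idealS In JI IJ.
split=> // JI'; apply: MT.
have JE : J = I by apply/seteqP.
have sT : nonzero_ideal [set: R] by apply: nonzero_idealS Mn _ _.
apply: (ideals_invertible_cancel inv Mn sT In).
by rewrite -{1}JE MJ set_prodC ideal_prodT.
Qed.

Lemma big_prod_ideal n (N : 'I_n -> set R) : (forall i, is_ideal (N i)) ->
  is_ideal (\big[@set_prod R/setT]_(i < n) N i).
Proof.
by move=> NI; apply: big_ind => // I J; apply: ideal_prod.
Qed.

Lemma big_prod_factor n (N : 'I_n -> set R) j : (forall i, is_ideal (N i)) ->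
  exists J, \big[@set_prod R/setT]_(i < n) N i = set_prod (N j) J.
Proof.
elim: n N j => [|n IHn] N j NI; first by case: j.
rewrite big_ord_recl; case: (unliftP ord0 j) => [k ->|->]; last by eexists.
have [J ->] := IHn (fun i => N (lift ord0 i)) k (fun i => NI _).
by exists (set_prod (N ord0) J); rewrite set_prodA [set_prod (N ord0) _]set_prodC
  -set_prodA.
Qed.

Lemma prime_big_prod_sub P n (N : 'I_n -> set R) : prime_ideal P ->
  (forall i, is_ideal (N i)) ->
  \big[@set_prod R/setT]_(i < n) N i `<=` P -> exists i, N i `<=` P.
Proof.
move=> PP; elim: n N => [|n IHn] N NI.
  by rewrite big_ord0 => sP; case: (prime_ideal1 PP); apply: sP.
rewrite big_ord_recl => sP.
have restI := big_prod_ideal (fun i => NI (lift ord0 i)).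
have [N0P|restP] := prime_prod_sub PP restI sP; first by exists ord0.
by have [//|i NiP] := IHn _ _ restP; exists (lift ord0 i).
Qed.

Lemma maximal_subset_eq M P : maximal_ideal M -> prime_ideal P -> M `<=` P ->
  M = P.
Proof. by move=> [_ _ Mmax] [PI PT _] MP; case: (Mmax P PI MP) => [->|]. Qed.

(** A nonzero maximal ideal [M] contains some [a != 0]; the maximal factors of
    [(a)] are invertible, and since [M] is prime it is one of them. *)
Lemma product_of_maximal_invertible :
  (forall I, nonzero_ideal I -> I <> setT -> product_of_maximal_ideals I) ->
  ideals_invertible.
Proof.
move=> prod.
have maxinv M : maximal_ideal M -> nonzero_ideal M ->
    invertible_submodule (toK @` M).
  move=> MM /nonzero_idealP [MI [a Ma a0]]; have [_ MT _] := MM.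
  have aM := principal_sub MI Ma; have MP := maximal_prime MM.
  have [|n [N [NM aE]]] := prod _ (nonzero_principal a0).
    by move=> aT; apply: MT; apply/seteqP; split=> // x _; apply: aM; rewrite aT.
  have NI i : is_ideal (N i) by case: (NM i).
  have [|j NjM] := @prime_big_prod_sub M n N MP NI; first by rewrite -aE.
  rewrite -(maximal_subset_eq (NM j) MP NjM).
  have [J NJ] := big_prod_factor j NI.
  by apply: (@principal_prod_invertible R _ J a) => //; rewrite -NJ.
move=> I In; have [->|IT] := pselect (I = setT); first exact: invertible_range.
have [n [N [NM IE]]] := prod I In IT.
have NI i : is_ideal (N i) by case: (NM i).
have Ninv i : invertible_submodule (toK @` N i).
  apply: maxinv => //; apply: nonzero_idealS In (NI i) _; rewrite IE.
  by have [J ->] := big_prod_factor i NI; apply: ideal_prod_subl.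
rewrite IE; apply: (big_ind (fun J => invertible_submodule (toK @` J))) => //.
  exact: invertible_range.
by move=> J L; rewrite toK_image_prod; apply: invertible_mul.
Qed.

End Invertible.

(** * Dedekind domains have invertible ideals *)

Section Dedekind.
Variable R : idomainType.
Local Notation K := {fraction R}.
Local Notation toK := (@FracField.tofrac R).
Implicit Types (I J P M : set R) (X Y : set K).

(** The determinant trick: on generators of [I], multiplication by [x] is given
    by a matrix over [R], of which [x] is an eigenvalue. *)
Lemma integral_stabilizer I (x : K) : nonzero_ideal I ->
  finitely_generated I -> (forall b, I b -> (toK @` I) (x * toK b)) ->
  integralOver toK x.
Proof.
move=> /nonzero_idealP [_ [a Ia a0]] [n [g IE]] xI.
have [c cE] : {c : 'I_n -> 'I_n -> R &
    forall i, x * toK (g i) = toK (\sum_j c i j * g j)}.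
  apply: (@choice _ _ (fun i ci => x * toK (g i) = toK (\sum_j ci j * g j))).
  move=> i; have : I (g i) by rewrite IE; apply: span_gen.
  by move/xI => [b]; rewrite {1}IE => -[ci ->] <-; exists ci.
pose A := \matrix_(j, i) c i j.
exists (char_poly A); first exact: char_poly_monic.
rewrite map_char_poly -eigenvalue_root_char; apply/eigenvalueP.
exists (\row_i toK (g i)).
  apply/rowP => i; rewrite !mxE cE rmorph_sum; apply: eq_bigr => j _.
  by rewrite !mxE /= -rmorphM mulrC.
apply: contra_neq a0 => g0; move: Ia; rewrite IE => -[d ->].
rewrite big1 // => i _; apply: toK_inj.
by have /rowP/(_ i) := g0; rewrite !mxE rmorphM /= rmorph0 => ->; rewrite mulr0.
Qed.

Definition colon (a b : R) : set R := [set z | principal_ideal a (z * b)].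

Lemma colon_ideal a b : is_ideal (colon a b).
Proof.
have [a0 aD aM] := principal_is_ideal a; rewrite /colon; split=> /=.
- by rewrite mul0r.
- by move=> x y; rewrite mulrDl; apply: aD.
- by move=> c x; rewrite -mulrA; apply: aM.
Qed.

Lemma colonMr a b c : colon a b `<=` colon a (b * c).
Proof.
move=> z; rewrite /colon /= mulrA [z * b * c]mulrC.
by have [_ _] := principal_is_ideal a; apply.
Qed.

(** Let [0 != a] in [P]. Among the ideals [(a : b)] contained in [P] there is
    a maximal one, and it is prime; nonzero primes being maximal, it is [P].
    Then [b / a] multiplies [P] into [R] but is not in [R]. *)
Lemma inverse_of_prime_gt P : noetherian R ->
  (forall Q : set R, prime_ideal Q -> Q <> [set 0] -> maximal_ideal Q) ->
  prime_ideal P -> P <> [set 0] ->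
  exists x : K, ~ range toK x /\ forall p, P p -> range toK (x * toK p).
Proof.
move=> noeth dim1 PP Pn0; have [PI PT PM] := PP.
have /nonzero_idealP [_ [a Pa a0]] : nonzero_ideal P by [].
pose F := [set J : set R | exists2 b, J = colon a b & J `<=` P].
have [|||Q [b QE QP] Qmax] := @noetherian_maximal _ F.
- by [].
- by move=> _ [b -> _]; apply: colon_ideal.
- exists (colon a 1); exists 1 => // z; rewrite /colon /= mulr1.
  exact: principal_sub.
have QI : is_ideal Q by rewrite QE; apply: colon_ideal.
have Qa : Q a.
  by rewrite QE /colon /=; apply/principal_idealP; exists b; rewrite mulrC.
have grow c x : ~ Q x -> colon a (b * c) x -> exists2 s, ~ P s & colon a (b * c) s.
  move=> nQx cx; apply: contrapT => nos; apply: nQx.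
  rewrite -(Qmax (colon a (b * c))) //; last by rewrite QE; apply: colonMr.
  by exists (b * c) => // s cs; apply: contrapT => nPs; apply: nos; exists s.
have QQ : prime_ideal Q.
  split=> //; first by move=> QT; apply: (prime_ideal1 PP); apply: QP; rewrite QT.
  move=> x y Qxy; apply: contrapT => /not_orP [nQx nQy].
  have [|s nPs cs] := grow x y nQy.
    by move: Qxy; rewrite QE /colon /=; congr (principal_ideal a _); ring.
  have [|t nPt ct] := grow s x nQx.
    by move: cs; rewrite /colon /=; congr (principal_ideal a _); ring.
  apply: (prime_idealM PP nPt nPs); apply: QP.
  by move: ct; rewrite QE /colon /=; congr (principal_ideal a _); ring.
have QPe : Q = P.
  apply: maximal_subset_eq PP QP; apply: dim1 => // Q0; move: Qa.
  by rewrite Q0 => a0'; rewrite a0' eqxx in a0.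
have a0' := toK_neq0 a0.
exists (toK b / toK a); split.
  move=> [r _ rE]; apply: (prime_ideal1 PP); apply: QP.
  rewrite QE /colon /= mul1r; apply/principal_idealP; exists r.
  by apply: toK_inj; rewrite rmorphM /= rE divfK.
move=> p; rewrite -QPe QE => /principal_idealP [c cE]; exists c => //.
by rewrite mulrAC -rmorphM [b * p]mulrC cE rmorphM /= mulfK.
Qed.

(** Noetherian induction: for [I] in a maximal ideal [P], take [x] as in
    [inverse_of_prime_gt]. The ideal [I P^-1] of [R] contains [I], and
    [I P^-1 = I] would give [x I <= I], making [x] integral; hence [I P^-1] is
    larger than [I], so invertible, and [I] divides it. *)
Lemma dedekind_invertible : dedekind_domain R -> ideals_invertible R.
Proof.
move=> [intcl noeth dim1] I In; have [II _] := In; move: I II In.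
apply: (@noetherian_ind _ (fun I => nonzero_ideal I ->
  invertible_submodule (toK @` I))) => // I II IH In.
have [->|IT] := pselect (I = setT); first exact: invertible_range.
have [P PM IP] := ex_maximal_ideal noeth II IT.
have PP := maximal_prime PM; have [PI _ _] := PP.
have [_ Pn0] := nonzero_idealS In PI IP.
have [x [nRx xP]] := inverse_of_prime_gt noeth dim1 PP Pn0.
pose Z := inv_submodule (toK @` P).
have Z1 : Z 1 by move=> _ [p _ <-]; exists p; rewrite ?mulr1.
have Zx : Z x by move=> _ [p Pp <-]; rewrite mulrC; apply: xP.
have IZR : set_prod (toK @` I) Z `<=` range toK.
  apply: subset_trans (@prod_inv_sub _ (toK @` P)); apply: set_prodS => //.
  by move=> _ [i Ii <-]; exists i => //; apply: IP.
pose J := toK @^-1` set_prod (toK @` I) Z.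
have JE : toK @` J = set_prod (toK @` I) Z := image_preimage_toK IZR.
have IJ : I `<=` J.
  move=> i Ii; rewrite /J /preimage /= -[toK i]mulr1.
  by apply: set_prod_mul => //; apply/toK_image.
have JI : is_ideal J.
  by apply/submodule_preimage/submodule_prod/ideal_submodule.
have properJ : I `<` J.
  split=> // sJI; apply: nRx; apply: intcl.
  apply: integral_stabilizer In (noeth I II) _ => i Ii.
  have /seteqP JI' : J `<=` I /\ I `<=` J by [].
  by rewrite -JI' JE mulrC; apply: set_prod_mul => //; rewrite JI'; apply/toK_image.
have [_ [Y [YS JY]]] := IH J JI properJ (nonzero_idealS In JI IJ).
split; first exact: ideal_submodule.
exists (set_prod Z Y); split; first exact/submodule_prod/inv_submodule_submodule.
by rewrite set_prodA -JE.
Qed.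

(** * Cancellation domains *)

Definition ideal_cancellation := forall I1 I2 J,
  nonzero_ideal I1 -> nonzero_ideal I2 -> nonzero_ideal J ->
  set_prod I1 J = set_prod I2 J -> I1 = I2.

(** Division by the monic polynomial of which [a / b] is a root bounds the
    degree, so a fixed power of [b] clears the denominators of [R[a / b]]. *)
Lemma integral_denominator (x : K) : integralOver toK x ->
  exists2 d, d != 0 &
    forall p, exists r, toK r = toK d * (map_poly toK p).[x].
Proof.
have [a [b [b0 ->]]] := fractionP x => -[f fM fx].
have b0' := toK_neq0 b0.
exists (b ^+ size f); first by rewrite expf_neq0.
move=> p; rewrite (Pdiv.RingMonic.rdivp_eq fM p) rmorphD rmorphM /= hornerD.
rewrite hornerM (rootP fx) mulr0 add0r.
have := Pdiv.Ring.ltn_rmodpN0 p (monic_neq0 fM).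
move: (Pdiv.Ring.rmodp p f) => q qf.
exists (\sum_(i < size q) q`_i * a ^+ i * b ^+ (size f - i)).
rewrite horner_coef (size_map_inj_poly (@toK_inj R) (rmorph0 _)) mulr_sumr rmorph_sum.
apply: eq_bigr => i _ /=; have ileq : (i <= size f)%N.
  exact: ltnW (ltn_trans (ltn_ord i) qf).
rewrite coef_map !rmorphM !rmorphXn /= expr_div_n.
have -> : toK b ^+ size f = toK b ^+ (size f - i) * toK b ^+ i.
  by rewrite -exprD subnK.
have clear_denominator (F : fieldType) (c w y z : F) : y != 0 ->
    z * y * (c * (w / y)) = c * w * z by move=> y0; field.
exact/esym/clear_denominator/expf_neq0.
Qed.

(** With [d] as above, [J = d R[x]] is an ideal with [J J = (d) J]; cancelling
    [J] gives [J = (d)], so [x] lies in [R]. *)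
Lemma cancellation_integrally_closed :
  ideal_cancellation -> integrally_closed R.
Proof.
move=> cancel x /integral_denominator [d d0 dR]; have d0' := toK_neq0 d0.
pose ev (p : {poly R}) := (map_poly toK p).[x].
have evD p q : ev (p + q) = ev p + ev q by rewrite /ev rmorphD hornerD.
have evM p q : ev (p * q) = ev p * ev q by rewrite /ev rmorphM hornerM.
have evC c : ev c%:P = toK c by rewrite /ev map_polyC hornerC.
pose J := [set r | exists p, toK r = toK d * ev p].
have Jd : J d by exists 1; rewrite evC rmorph1 mulr1.
have [JD JM] : (forall r s, J r -> J s -> J (r + s)) /\
    forall c r, J r -> J (c * r).
  split=> [r s [p rp] [q sq]|c r [p rp]].
    by exists (p + q); rewrite rmorphD /= rp sq evD mulrDr.
  by exists (c%:P * p); rewrite rmorphM /= rp evM evC mulrCA.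
have J0 : J 0 by rewrite -[0](mul0r d); apply: JM.
have JI : is_ideal J by [].
have Jn : nonzero_ideal J by apply/nonzero_idealP; split=> //; exists d.
have JE : J = principal_ideal d.
  apply: (cancel _ _ J) => //; first exact: nonzero_principal.
  apply/seteqP; split; last by apply: set_prodS => //; apply: principal_sub.
  have [P0 PD _] := ideal_prod (principal_is_ideal d) JI.
  apply: set_prod_sub => // r s [p rp] [q sq].
  have [t tE] := dR (p * q).
  have -> : r * s = d * t.
    apply: toK_inj; rewrite !rmorphM /= rp sq tE -/(ev _) evM.
    by rewrite -!mulrA; congr (_ * _); rewrite mulrCA.
  by apply: set_prod_mul; [apply: principal_id|exists (p * q)].
have [r rE] := dR 'X.
have /principal_idealP [c cE] : principal_ideal d r by rewrite -JE; exists 'X.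
exists c => //; apply: (mulIf d0'); rewrite -rmorphM /= -cE rE map_polyX hornerX.
exact: mulrC.
Qed.

Definition pair_ideal (a b : R) : set R :=
  [set z | exists r s, z = r * a + s * b].

Lemma pair_is_ideal a b : is_ideal (pair_ideal a b).
Proof.
split; first by exists 0, 0; ring.
  by move=> _ _ [r [s ->]] [r' [s' ->]]; exists (r + r'), (s + s'); ring.
by move=> c _ [r [s ->]]; exists (c * r), (c * s); ring.
Qed.

Lemma pair_ideal_nonzero a b : a != 0 -> nonzero_ideal (pair_ideal a b).
Proof.
move=> a0; apply/nonzero_idealP; split; first exact: pair_is_ideal.
by exists a => //; exists 1, 0; ring.
Qed.

(** Cancel [(a, b)] in the identity [(a, b)^2 (a, b) = (a^2, b^2) (a, b)]. *)
Lemma cancellation_mul_squares (a b : R) : ideal_cancellation -> a != 0 ->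
  exists e f, a * b = e * a ^+ 2 + f * b ^+ 2.
Proof.
move=> cancel a0; pose I := pair_ideal a b; pose L := pair_ideal (a ^+ 2) (b ^+ 2).
have In : nonzero_ideal I := pair_ideal_nonzero b a0.
have Ln : nonzero_ideal L by apply: pair_ideal_nonzero; rewrite expf_neq0.
have Ia : I a by exists 1, 0; ring.
have Ib : I b by exists 0, 1; ring.
suff IIE : set_prod I I = L by change (L (a * b)); rewrite -IIE; apply: set_prod_mul.
apply: (cancel _ _ I) => //; first exact: nonzero_ideal_prod.
apply/seteqP; split; last first.
  apply: set_prodS => // _ [r [s ->]]; have [II _] := In.
  have [_ IID IIM] := ideal_prod II II.
  by apply: (IID); apply: IIM; apply: set_prod_mul.
have [LI0 LID LIM] := ideal_prod (pair_is_ideal (a ^+ 2) (b ^+ 2))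
  (pair_is_ideal a b).
have La : L (a ^+ 2) by exists 1, 0; ring.
have Lb : L (b ^+ 2) by exists 0, 1; ring.
rewrite -set_prodA; apply: set_prod_sub => // x w [r [s ->]].
apply: (@set_prod_sub _ I I (fun w => set_prod L I ((r * a + s * b) * w))).
- by rewrite mulr0.
- by move=> u v xu xv; rewrite mulrDr; apply: LID.
move=> _ _ [r1 [s1 ->]] [r2 [s2 ->]].
pose al := r * r1 * r2; pose be := r * r1 * s2 + r * s1 * r2 + s * r1 * r2.
pose ga := r * s1 * s2 + s * r1 * s2 + s * s1 * r2; pose de := s * s1 * s2.
have -> : (r * a + s * b) * ((r1 * a + s1 * b) * (r2 * a + s2 * b)) =
    a ^+ 2 * (al * a + be * b) + b ^+ 2 * (ga * a + de * b).
  by rewrite /al /be /ga /de; ring.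
by apply: LID; apply: set_prod_mul => //; [exists al, be|exists ga, de].
Qed.

(** With [a b = e a^2 + f b^2], the fraction [w = e a / b] is a root of
    [T^2 - T + e f]. *)
Lemma cancellation_pair (a b : R) : ideal_cancellation -> a != 0 -> b != 0 ->
  exists u e f, u * b = e * a /\ a = u * a + f * b.
Proof.
move=> cancel a0 b0; have [e [f ab]] := cancellation_mul_squares b cancel a0.
have b0' := toK_neq0 b0; pose w := toK e * toK a / toK b.
have ab' : toK a * toK b = toK e * toK a ^+ 2 + toK f * toK b ^+ 2.
  by rewrite -!rmorphXn -!rmorphM -rmorphD ab.
have [u _ uw] : range toK w.
  apply: (cancellation_integrally_closed cancel).
  exists ('X^2 - 'X + (e * f)%:P).
    rewrite monicE lead_coefDl ?lead_coefDl ?lead_coefXn //.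
      by rewrite size_polyXn size_polyN size_polyX.
    by rewrite (leq_ltn_trans (size_polyC_leq1 _)) // size_polyDl ?size_polyXn
      ?size_polyN ?size_polyX.
  apply/rootP; rewrite rmorphD rmorphB /= map_polyXn map_polyX map_polyC /=.
  rewrite !hornerE rmorphM /=.
  have quadratic (F : fieldType) (x y s t : F) : y != 0 ->
      (s * x / y) ^+ 2 - s * x / y + s * t =
      s / y ^+ 2 * (s * x ^+ 2 + t * y ^+ 2 - x * y) by move=> y0; field.
  by rewrite quadratic // -ab' subrr mulr0.
have ub : u * b = e * a.
  by apply: toK_inj; rewrite !rmorphM /= uw divfK.
exists u, e, f; split=> //; apply: (mulfI b0).
by rewrite mulrDr mulrA [b * u]mulrC ub [LHS]mulrC ab; ring.
Qed.

(** Suppose [x] is outside the prime [P]. Applied to [p] in [P] and [x],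
    [cancellation_pair] gives [u] and [f] in [P] with [p = u p + f x]; hence
    [P = P (P + (x))], and cancelling [P] leaves [P + (x) = R]. *)
Lemma cancellation_prime_maximal P : ideal_cancellation -> prime_ideal P ->
  P <> [set 0] -> maximal_ideal P.
Proof.
move=> cancel PP Pn0; have [PI PT PM] := PP; split=> // J JI PJ.
have [JP|/existsNP [x /not_implyP [Jx nPx]]] := pselect (J `<=` P).
  by left; apply/seteqP.
right; have [P0 PD PMl] := PI; have [J0 JD JM] := JI.
pose N := [set z | exists q r, P q /\ z = q + r * x].
have NI : is_ideal N.
  split; first by exists 0, 0; split=> //; ring.
    move=> _ _ [q [r [Pq ->]]] [q' [r' [Pq' ->]]].
    by exists (q + q'), (r + r'); split; [apply: PD|ring].
  move=> c _ [q [r [Pq ->]]]; exists (c * q), (c * r).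
  by split; [apply: PMl|ring].
have PN : P `<=` N by move=> q Pq; exists q, 0; split=> //; ring.
have Nx : N x by exists 0, 1; split=> //; ring.
have Pn : nonzero_ideal P by [].
have Tn : nonzero_ideal [set: R] by apply: nonzero_idealS Pn _ _.
suff NT : N = setT.
  apply: ideal_setT => //; have : N 1 by rewrite NT.
  by move=> [q [r [Pq ->]]]; apply: JD; [apply: PJ|apply: JM].
apply: (cancel _ _ P) => //; first exact: nonzero_idealS Pn NI PN.
rewrite [RHS]set_prodC ideal_prodT // set_prodC; apply/seteqP; split.
  exact: ideal_prod_subl.
move=> p Pp; have [->|p0] := eqVneq p 0; first exact: set_prod0.
have x0 : x != 0 by apply/eqP => x0; apply: nPx; rewrite x0.
have [u [e [f [ux pE]]]] := cancellation_pair cancel p0 x0.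
have Pu : P u.
  have [//|//] : P u \/ P x by apply: PM; rewrite ux; apply: PMl.
have Pf : P f.
  have [//|//] : P f \/ P x; apply: PM.
  have -> : f * x = p + (- u) * p by rewrite {1}pE; ring.
  by apply: PD => //; apply: PMl.
rewrite pE; apply: set_prodD; apply: set_prod_mul => //.
exact: PN.
Qed.

End Dedekind.

(** * The valuation of a uniformizer *)

Section Uniformizer.
Variables (F : fieldType) (A : set F).

Definition subring_units : set F := [set u | [/\ u != 0, A u & A u^-1]].

Variable p : F.
Hypotheses (A0 : A 0) (A1 : A 1).
Hypothesis AD : forall x y, A x -> A y -> A (x + y).
Hypothesis AM : forall x y, A x -> A y -> A (x * y).
Hypotheses (Ap : A p) (nAp : ~ A p^-1).
Hypothesis factor : forall x, x != 0 ->
  exists n : int, exists2 u, subring_units u & x = p ^ n * u.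

Local Notation U := subring_units.

Lemma uniformizer_neq0 : p != 0.
Proof. by apply/eqP => p0; apply: nAp; rewrite p0 invr0. Qed.

Local Notation p0 := uniformizer_neq0.

Lemma uniformizer_expP n u : U u -> A (p ^ n * u) <-> 0 <= n.
Proof.
move=> [u0 Au AVu]; have AX k : A (p ^+ k).
  by elim: k => [|k IHk]; [rewrite expr0|rewrite exprS; apply: AM].
case: n => n; split=> //.
  by move=> _; apply: AM => //; apply: AX.
move=> /AM/(_ AVu); rewrite mulfK // => /AM/(_ (AX n)).
by rewrite NegzE -exprnN exprS invfM divfK ?expf_neq0 ?p0.
Qed.

Definition adic_valuation x : int :=
  xget 0 [set n | exists2 u, U u & x = p ^ n * u].

Lemma adic_valuationP x : x != 0 ->
  exists2 u, U u & x = p ^ adic_valuation x * u.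
Proof. by move/factor; apply: xgetPex. Qed.

Lemma subring_unitsM u v : U u -> U v -> U (u * v).
Proof.
move=> [u0 Au AVu] [v0 Av AVv]; split; [by rewrite mulf_neq0|exact: AM|].
by rewrite invfM; apply: AM.
Qed.

Lemma uniformizer_exp_eq m n u v : U u -> U v -> p ^ m * u = p ^ n * v -> m = n.
Proof.
have le i j x y : U x -> U y -> p ^ i * x = p ^ j * y -> i <= j.
  move=> Ux [y0 Ay AVy] e; rewrite -subr_ge0 -(uniformizer_expP _ (_ : U 1)).
    have -> : p ^ (j - i) * 1 = x * y^-1; last by case: Ux => _ Ax _; apply: AM.
    apply: (mulIf y0); rewrite mulr1 divfK // expfzDr ?p0 // mulrAC -e mulrAC.
    by rewrite -expfzDr ?p0 // subrr expr0z mul1r.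
  by split; rewrite ?oner_neq0 ?invr1.
by move=> Uu Uv e; apply/eqP; rewrite eq_le (le _ _ _ _ Uu Uv e)
  (le _ _ _ _ Uv Uu (esym e)).
Qed.

Lemma adic_valuation_eq n u : U u -> adic_valuation (p ^ n * u) = n.
Proof.
move=> Uu; have [u0 _ _] := Uu; have [|v Uv e] := @adic_valuationP (p ^ n * u).
  by rewrite mulf_neq0 // expfz_neq0 // p0.
exact/esym/uniformizer_exp_eq/e.
Qed.

Lemma adic_valuation_ge0 x : x != 0 -> A x <-> 0 <= adic_valuation x.
Proof.
by move=> x0; have [u Uu {1}->] := adic_valuationP x0; apply: uniformizer_expP.
Qed.

Lemma adic_valuation_discrete : discrete_valuation adic_valuation.
Proof.
have U1 : U 1 by split; rewrite ?oner_neq0 ?invr1.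
split.
- move=> x y x0 y0; have [u Uu xE] := adic_valuationP x0.
  have [w Uw yE] := adic_valuationP y0.
  rewrite {1}xE {1}yE mulrACA -expfzDr ?p0 // adic_valuation_eq //.
  exact: subring_unitsM.
- move=> n; exists (p ^ n); split; first by rewrite expfz_neq0 ?p0.
  by rewrite -[p ^ n]mulr1 adic_valuation_eq.
move=> x y; wlog le_xy : x y / adic_valuation x <= adic_valuation y.
  move=> W; have [xy|xy] := leP (adic_valuation x) (adic_valuation y).
    by move=> x0 y0 xy0; have := W x y xy x0 y0 xy0; rewrite min_l.
  move=> x0 y0; rewrite addrC => yx0.
  by have := W y x (ltW xy) y0 x0 yx0; rewrite min_l // ltW.
move=> x0 y0 xy0; rewrite min_l //.
have [u Uu xE] := adic_valuationP x0; have [w Uw yE] := adic_valuationP y0.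
set n := adic_valuation x in le_xy xE *; set m := adic_valuation y in le_xy yE.
(* dividing by the power of [p] in [x] reduces the inequality to [A] being
   closed under addition *)
pose z := u + p ^ (m - n) * w.
have zE : x + y = p ^ n * z.
  by rewrite /z mulrDr mulrA -expfzDr ?p0 // subrKC -xE -yE.
have z0 : z != 0 by apply: contra_neq xy0 => z0; rewrite zE z0 mulr0.
have Az : A z.
  by apply: AD; [case: Uu|apply/(uniformizer_expP _ Uw); rewrite subr_ge0].
move/(adic_valuation_ge0 z0): Az; have [t Ut tE] := adic_valuationP z0.
by rewrite zE [in X in _ -> X]tE mulrA -expfzDr ?p0 // adic_valuation_eq // lerDl.
Qed.

Lemma adic_valuation_ring : valuation_ring adic_valuation = A.
Proof.
apply/seteqP; split=> [x|x Ax].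
  have [-> _ //|x0 [xe|]] := eqVneq x 0; first by rewrite xe eqxx in x0.
  by move/(adic_valuation_ge0 x0).
have [->|x0] := eqVneq x 0; first by left.
by right; apply/(adic_valuation_ge0 x0).
Qed.

Lemma subring_isom_refl (E : comNzRingType) (B : set E) : subring_isom B B.
Proof. by exists idfun; split=> //; split=> // x Bx; exists x. Qed.

(** When every nonzero element of the field is a power of the non-unit [p]
    times a unit of the subring [A], the exponent is well defined; it is a
    valuation, and [A] is its ring. *)
Lemma uniformizer_is_DVR : is_DVR A.
Proof.
exists F, adic_valuation; split; first exact: adic_valuation_discrete.
rewrite adic_valuation_ring; exact: subring_isom_refl.
Qed.

End Uniformizer.

(** * Localizations and discrete valuations *)

Section Localization.
Variable R : idomainType.
Local Notation K := {fraction R}.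
Local Notation toK := (@FracField.tofrac R).
Implicit Types (I J P M : set R) (x y z u : K).

Lemma prime_neq0 P s : prime_ideal P -> ~ P s -> s != 0.
Proof. by move=> [[P0 _ _] _ _] nPs; apply/eqP => s0; apply: nPs; rewrite s0. Qed.

Lemma localization_toK P a : prime_ideal P -> localization_at P (toK a).
Proof.
by move=> PP; exists a, 1; split; [exact: prime_ideal1|rewrite rmorph1 divr1].
Qed.

Lemma localizationM P x y : prime_ideal P ->
  localization_at P x -> localization_at P y -> localization_at P (x * y).
Proof.
move=> PP [a [s [nPs ->]]] [b [t [nPt ->]]].
exists (a * b), (s * t); split; first exact: prime_idealM.
by rewrite !rmorphM invfM mulrACA.
Qed.

Lemma localizationD P x y : prime_ideal P ->
  localization_at P x -> localization_at P y -> localization_at P (x + y).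
Proof.
move=> PP [a [s [nPs ->]]] [b [t [nPt ->]]].
exists (a * t + b * s), (s * t); split; first exact: prime_idealM.
by rewrite addf_div ?toK_neq0 ?(prime_neq0 PP) // rmorphD !rmorphM.
Qed.

(** In a valuation ring an element divides those of larger valuation, so an
    element of [I] of least valuation generates [I] locally. *)
Lemma DVR_locally_principal M I : prime_ideal M ->
  is_DVR (localization_at M) -> nonzero_ideal I ->
  exists a, [/\ I a, a != 0 &
    forall b, I b -> exists s c, ~ M s /\ s * b = a * c].
Proof.
move=> MP [F [v [[vM _ _] [f [[fO finj fsurj] _ fD fM]]]]].
move=> /nonzero_idealP [II [a Ia a0]].
have L := fun r => localization_toK r MP.
pose g r := f (toK r).
have g0 : f 0 = 0.
  have L0 := L 0; rewrite rmorph0 in L0.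
  by apply: (addrI (f 0)); rewrite -fD // !addr0.
have gn0 r : r != 0 -> g r != 0.
  move=> r0; apply: contra_neq r0; rewrite /g -g0 -(rmorph0 toK) => /finj e.
  by apply/toK_inj/e; rewrite inE; apply: L.
have gO r : r != 0 -> 0 <= v (g r).
  by move=> /gn0 /eqP gr0; have [] := fO _ (L r).
pose Q n := `[< exists r, [/\ I r, r != 0 & v (g r) = Posz n] >].
have exQ : exists n, Q n.
  exists `|v (g a)|%N; apply/asboolP; exists a; split=> //.
  by rewrite gez0_abs // gO.
have [n /asboolP [m [Im m0 vm]] nmin] := ex_minnP exQ.
exists m; split=> // b Ib; have [->|b0] := eqVneq b 0.
  by exists 1, 0; split; [exact: prime_ideal1|rewrite !mulr0].
have vq : 0 <= v (g b / g m).
  have := vM (g b / g m) (g m); rewrite mulf_neq0 ?invr_eq0 ?gn0 // divfK ?gn0 //.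
  move=> /(_ isT isT) vb; rewrite -(lerD2r (v (g m))) add0r -vb vm.
  rewrite -(gez0_abs (gO _ b0)) lez_nat; apply: nmin; apply/asboolP.
  by exists b; rewrite gez0_abs ?gO.
have [c Lc cE] := fsurj (g b / g m) (or_intror vq).
have : toK b = c * toK m.
  apply: finj; rewrite ?inE //; first exact: localizationM.
  by rewrite fM // cE divfK // gn0.
have [r [s [nMs ->]]] := Lc; move=> e; exists s, r; split=> //.
have s0 : toK s != 0 by apply/toK_neq0/(prime_neq0 MP).
apply: toK_inj; rewrite !rmorphM /= e.
by rewrite [LHS]mulrC mulrAC divfK // [LHS]mulrC.
Qed.

(** If [I I^-1] were in a maximal ideal [M], let [a] generate [I] locally at
    [M]. A common denominator [s] outside [M] for the generators of [I] gives
    [s / a] in [I^-1], so [s] would be in [I I^-1]. *)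
Lemma locally_DVR_invertible : noetherian R ->
  (forall M, maximal_ideal M -> M <> [set 0] -> is_DVR (localization_at M)) ->
  ideals_invertible R.
Proof.
move=> noeth dvr I In; have [II _] := In; have IS := ideal_submodule II.
apply/invertibleP; split=> //.
pose Z := inv_submodule (toK @` I); pose J := toK @^-1` set_prod (toK @` I) Z.
have JI : is_ideal J by apply/submodule_preimage/submodule_prod.
suff J1 : J = setT by rewrite -(rmorph1 toK); change (J 1); rewrite J1.
apply: contrapT => JT; have [M MM JM] := ex_maximal_ideal noeth JI JT.
have IJ : I `<=` J.
  move=> i Ii; rewrite /J /preimage /= -[toK i]mulr1; apply: set_prod_mul.
    exact/toK_image.
  by move=> _ [k _ <-]; exists k; rewrite ?mulr1.
have MP := maximal_prime MM; have [MI _ _] := MM.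
have [_ Mn0] := nonzero_idealS In MI (subset_trans IJ JM).
have [a [Ia a0 aI]] := DVR_locally_principal MP (dvr M MM Mn0) In.
have a0' := toK_neq0 a0.
have [n [g IE]] := noeth I II.
have [s sE] : {s : 'I_n -> R & forall i, ~ M (s i) /\
    exists c, s i * g i = a * c}.
  apply: (@choice _ _ (fun i s => ~ M s /\ exists c, s * g i = a * c)) => i.
  have [|s [c [nMs sg]]] := aI (g i); first by rewrite IE; apply: span_gen.
  by exists s; split=> //; exists c.
pose t := \prod_i s i.
have nMt : ~ M t.
  rewrite /t; elim/big_ind: _ => [|x y|i _]; first exact: prime_ideal1.
    exact: prime_idealM.
  by case: (sE i).
apply/nMt/JM; rewrite /J /preimage /= -[toK t](divfK a0') mulrC.
apply: set_prod_mul; first exact/toK_image.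
suff tI : I `<=` [set b | principal_ideal a (t * b)].
  move=> _ [b /tI [r _ rE] <-]; exists r => //.
  by rewrite mulrA -rmorphM [b * t]mulrC -rE rmorphM mulrAC divff // mul1r.
have [aI0 aID aIM] := principal_is_ideal a.
move=> b; rewrite IE => -[c ->]; rewrite /= mulr_sumr; apply: big_ind => // i _.
rewrite mulrCA; apply: (aIM); rewrite /t (bigD1 i) //=.
have [_ [d sg]] := sE i; rewrite mulrAC sg mulrC; apply: (aIM).
by exists d.
Qed.

(** Cancellation gives [p] in [P] outside [P P]; write [(p) = P J]. An element
    [s] of [J] outside [P] multiplies [P] into [(p)]. *)
Lemma prime_locally_principal P : ideals_invertible R -> prime_ideal P ->
  P <> [set 0] -> exists p, [/\ P p, p != 0 &
    forall q, P q -> exists s c, ~ P s /\ s * q = p * c].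
Proof.
move=> inv PP Pn0; have [PI PT _] := PP; have Pn : nonzero_ideal P by [].
have [sPP|/existsNP [p /not_implyP [Pp nPPp]]] := pselect (P `<=` set_prod P P).
  case: PT; have Tn : nonzero_ideal [set: R] by apply: nonzero_idealS Pn _ _.
  apply: (ideals_invertible_cancel inv Pn Tn Pn).
  rewrite [RHS]set_prodC ideal_prodT //; apply/seteqP; split=> //.
  exact: ideal_prod_subl.
have p0 : p != 0 by apply/eqP => p0; apply: nPPp; rewrite p0; apply: set_prod0.
have [J [JI PJ]] := ideals_invertible_dvd inv Pn (nonzero_principal p0)
  (principal_sub PI Pp).
exists p; split=> // q Pq.
have [sJP|/existsNP [s /not_implyP [Js nPs]]] := pselect (J `<=` P).
  case: nPPp; have : set_prod P J p by rewrite PJ; apply: principal_id.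
  exact: set_prodS.
have : set_prod P J (q * s) by apply: set_prod_mul.
by rewrite PJ => -[c _ cE]; exists s, c; rewrite cE mulrC.
Qed.

(** The ideal [r R_P] contracted to [R]. *)
Definition saturation P r : set R :=
  [set z | exists s, ~ P s /\ principal_ideal r (s * z)].

Lemma saturation_ideal P r : prime_ideal P -> is_ideal (saturation P r).
Proof.
move=> PP; have [r0 rD rM] := principal_is_ideal r; split.
- by exists 1; split; [exact: prime_ideal1|rewrite mulr0].
- move=> x y [s [nPs rx]] [t [nPt ry]]; exists (s * t).
  split; first exact: prime_idealM.
  have -> : s * t * (x + y) = t * (s * x) + s * (t * y) by ring.
  by apply: (rD); apply: (rM).
- by move=> a x [s [nPs rx]]; exists s; split=> //; rewrite mulrCA; apply: (rM).
Qed.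

(** Among the [r] with [a = p^n r] up to a unit of [R_P], one with maximal
    saturation is outside [P]: otherwise [r] is a unit times [p r'], and the
    saturation of [r'] is larger because [p] is not a unit. *)
Lemma prime_adic_factorization P (p : R) : noetherian R -> prime_ideal P ->
  P p -> (forall q, P q -> exists s c, ~ P s /\ s * q = p * c) ->
  forall a, a != 0 ->
    exists n s t, [/\ ~ P s, ~ P t & s * a = p ^+ n * t].
Proof.
move=> noeth PP Pp pP a a0; have [[_ _ PMl] _ _] := PP.
pose F := [set I : set R | exists r, I = saturation P r /\
  exists n s, ~ P s /\ s * a = p ^+ n * r].
have [|||_ [r [-> [n [s [nPs sa]]]]] rmax] := @noetherian_maximal _ F.
- by [].
- by move=> _ [r [-> _]]; apply: saturation_ideal.
- exists (saturation P a); exists a; split=> //; exists 0%N, 1.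
  by split; [exact: prime_ideal1|rewrite expr0].
exists n, s, r; split=> // Pr; have [t [r' [nPt tr]]] := pP r Pr.
have r0 : r != 0.
  by apply: contra_neq (mulf_neq0 (prime_neq0 PP nPs) a0) => r0; rewrite sa r0 mulr0.
have satE : saturation P r' = saturation P r.
  apply: rmax; last first.
    move=> z [u [nPu /principal_idealP [c uz]]]; exists (t * u).
    split; first exact: prime_idealM.
    apply/principal_idealP; exists (c * p).
    by rewrite -mulrA uz mulrCA tr mulrA.
  exists r'; split=> //; exists n.+1, (t * s); split; first exact: prime_idealM.
  by rewrite -mulrA sa mulrCA tr exprSr mulrA.
have [u [nPu /principal_idealP [c ur']]] : saturation P r r'.
  rewrite -satE; exists 1; split; first exact: prime_ideal1.
  by rewrite mul1r; apply: principal_id.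
apply: (prime_idealM PP nPu nPt); have -> : u * t = c * p; last exact: PMl.
by apply: (mulIf r0); rewrite -mulrA tr mulrCA ur' mulrCA mulrA.
Qed.

Lemma uniformizer_notin_inverse P p : prime_ideal P -> P p -> p != 0 ->
  ~ localization_at P (toK p)^-1.
Proof.
move=> PP Pp p0 [a [s [nPs e]]].
have p0' := toK_neq0 p0; have s0 : toK s != 0 by apply/toK_neq0/(prime_neq0 PP).
apply: nPs; have [[_ _ PM] _ _] := PP; have -> : s = a * p; last exact: PM.
have aE : toK a = (toK p)^-1 * toK s by rewrite e divfK.
by apply: toK_inj; rewrite rmorphM /= aE [RHS]mulrC mulVKf.
Qed.

Lemma localization_factorization P p (x : K) : prime_ideal P -> p != 0 ->
  (forall a, a != 0 -> exists n s t, [/\ ~ P s, ~ P t & s * a = p ^+ n * t]) ->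
  x != 0 -> exists n : int,
    exists2 u, subring_units (localization_at P) u & x = toK p ^ n * u.
Proof.
move=> PP p0 factor; have [a [b [b0 ->]]] := fractionP x => ab0.
have a0 : a != 0 by apply: contra_neq ab0 => ->; rewrite rmorph0 mul0r.
have [m [s [t [nPs nPt sa]]]] := factor a a0.
have [n [s' [t' [nPs' nPt' sb]]]] := factor b b0.
have toKn0 r : ~ P r -> toK r != 0 by move=> nPr; apply/toK_neq0/(prime_neq0 PP).
exists (m%:Z - n%:Z), (toK (t * s') / toK (s * t')).
  have [nPts nPst] := (prime_idealM PP nPt nPs', prime_idealM PP nPs nPt').
  split; first by rewrite mulf_neq0 ?invr_eq0 ?toKn0.
    by exists (t * s'), (s * t').
  by exists (s * t'), (t * s'); rewrite invf_div.
have regroup (F : fieldType) (q d e f g u v : F) : q != 0 -> f != 0 ->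
    g != 0 -> v != 0 -> f * e = q ^+ m * u -> g * d = q ^+ n * v ->
    e / d = q ^ (m%:Z - n%:Z) * (u * g / (f * v)).
  move=> q0 f0 g0 v0 fe gd; rewrite expfzDr // -exprnN -exprnP.
  have -> : e = q ^+ m * u / f by apply: (canRL (mulfK f0)); rewrite mulrC.
  have -> : d = q ^+ n * v / g by apply: (canRL (mulfK g0)); rewrite mulrC.
  by field; rewrite expf_neq0 // f0 v0 g0.
have tofrac_eqn r c k w : r * c = p ^+ k * w -> toK r * toK c = toK p ^+ k * toK w.
  by move/(congr1 toK); rewrite !rmorphM rmorphXn.
have -> : toK (t * s') / toK (s * t') =
    toK t * toK s' / (toK s * toK t') by rewrite !rmorphM.
exact: regroup (toK_neq0 p0) (toKn0 _ nPs) (toKn0 _ nPs') (toKn0 _ nPt')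
  (tofrac_eqn _ _ _ _ sa) (tofrac_eqn _ _ _ _ sb).
Qed.

Lemma localization_is_DVR P : ideals_invertible R -> prime_ideal P ->
  P <> [set 0] -> is_DVR (localization_at P).
Proof.
move=> inv PP Pn0; have noeth := ideals_invertible_noetherian inv.
have [p [Pp p0 pP]] := prime_locally_principal inv PP Pn0.
have factor := prime_adic_factorization noeth PP Pp pP.
apply: (@uniformizer_is_DVR _ _ (toK p)).
- by have := localization_toK 0 PP; rewrite rmorph0.
- by have := localization_toK 1 PP; rewrite rmorph1.
- by move=> x y; apply: localizationD.
- by move=> x y; apply: localizationM.
- exact: localization_toK.
- exact: uniformizer_notin_inverse.
- by move=> x; apply: localization_factorization.
Qed.

End Localization.

Theorem theorem129 (R : idomainType) :
  [<->
    (* (1) *)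
    dedekind_domain R;
    (* (2) *)
    forall I : set R, nonzero_ideal I ->
      invertible_submodule ((@FracField.tofrac R) @` I);
    (* (3) *)
    forms_group (@fractional_ideal R) (@set_prod {fraction R});
    (* (4) *)
    forall I : set R, nonzero_ideal I -> I <> setT ->
      product_of_maximal_ideals I;
    (* (5) *)
    noetherian R /\
    (forall M : set R, maximal_ideal M -> M <> [set 0] ->
      is_DVR (localization_at M));
    (* (6) *)
    noetherian R /\
    (forall P : set R, prime_ideal P -> P <> [set 0] ->
      is_DVR (localization_at P));
    (* (7) *)
    forall I J : set R, nonzero_ideal I -> nonzero_ideal J ->
      J `<=` I -> ideal_dvd I J;
    (* (8) *)
    noetherian R /\
    (forall I1 I2 J : set R,
      nonzero_ideal I1 -> nonzero_ideal I2 -> nonzero_ideal J ->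
      set_prod I1 J = set_prod I2 J -> I1 = I2);
    (* (9) *)
    forall I : set R, nonzero_ideal I ->
      exists J : set R, nonzero_ideal J /\ is_principal (set_prod I J)
  ].
Proof.
have dvr2 : (noetherian R /\ (forall P : set R, prime_ideal P ->
    P <> [set 0] -> is_DVR (localization_at P))) -> ideals_invertible R.
  move=> [noeth dvr]; apply: locally_DVR_invertible => // M MM.
  by apply: dvr; apply: maximal_prime.
have canc : ideals_invertible R -> ideal_cancellation R.
  by move=> inv I1 I2 J; apply: ideals_invertible_cancel.
have ded : noetherian R -> ideal_cancellation R -> dedekind_domain R.
  move=> noeth cancel; split=> //; first exact: cancellation_integrally_closed.
  by move=> P; apply: cancellation_prime_maximal.
tfae.
- exact: dedekind_invertible.
- exact: ideals_invertible_group.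
- by move/group_ideals_invertible => inv I In _;
     apply: ideals_invertible_product_of_maximal.
- move/product_of_maximal_invertible => inv.
  split; first exact: ideals_invertible_noetherian.
  by move=> M /maximal_prime MP; apply: localization_is_DVR.
- move=> [noeth dvr]; split=> // P; apply: localization_is_DVR.
  exact: locally_DVR_invertible.
- by move/dvr2 => inv I J; apply: ideals_invertible_dvd.
- move/divisibility_principal_multiple/principal_multiple_invertible => inv.
  by split; [exact: ideals_invertible_noetherian|exact: canc].
- move=> [noeth cancel]; have inv := dedekind_invertible (ded noeth cancel).
  by apply: divisibility_principal_multiple => I J; apply: ideals_invertible_dvd.
- move/principal_multiple_invertible => inv; apply: ded; last exact: canc.
  exact: ideals_invertible_noetherian.
Qed.
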